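(* Let $f:[0,1]\to\mathbb{R}^d$ be the self-affine function described in the context. If $f$ is differentiable at a point $t\in(0,1)$ (i.e. has a well-defined finite derivative there), then $f'(t)=0$.
   Context: Setting. Fix integers $d\geq 1$ and $m\geq 2$, let $\mathbf{a}=(0,0,\dots,0)$ and $\mathbf{b}=(1,0,\dots,0)$ in $\mathbb{R}^d$, and fix $\boldsymbol\varepsilon=(\varepsilon_1,\dots,\varepsilon_m)\in\{0,1\}^m$ (the signature). Let $S_1,\dots,S_m$ be contractive similitudes of $\mathbb{R}^d$ with ratios $\lambda_i:=\mathrm{Lip}(S_i)\in[0,1)$ (if $m\geq 3$ one or more $S_i$ may be constant, so $\lambda_i=0$; if $m=2$ all $\lambda_i>0$), satisfying $S_1((1-\varepsilon_1)\mathbf{a}+\varepsilon_1\mathbf{b})=\mathbf{a}$, $S_m(\varepsilon_m\mathbf{a}+(1-\varepsilon_m)\mathbf{b})=\mathbf{b}$, and $S_{i-1}(\varepsilon_{i-1}\mathbf{a}+(1-\varepsilon_{i-1})\mathbf{b})=S_i((1-\varepsilon_i)\mathbf{a}+\varepsilon_i\mathbf{b})$ for $i=2,\dots,m$. Let $c_1,\dots,c_m>0$ with $\sum_{i=1}^m c_i=1$, put $\sigma_i:=\sum_{j=1}^{i-1}c_j+\varepsilon_ic_i$, $\phi_i(t):=(-1)^{\varepsilon_i}c_it+\sigma_i$, and $I_i:=\phi_i([0,1])$. Then $f:[0,1]\to\mathbb{R}^d$ is the unique continuous function with $f(t)=S_i(f(\phi_i^{-1}(t)))$ for $t\in I_i$,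 $i=1,\dots,m$. It is assumed throughout that $(\lambda_1,\dots,\lambda_m)\neq(c_1,\dots,c_m)$. *)

(* Defs.v *)
From HB Require Import structures.
From mathcomp Require Import all_boot all_order all_algebra.
From mathcomp Require Import all_classical all_reals all_analysis.

Set Implicit Arguments.
Unset Strict Implicit.
Unset Printing Implicit Defensive.

Import Order.TTheory GRing.Theory Num.Theory.
Import numFieldNormedType.Exports.

Local Open Scope classical_set_scope.
Local Open Scope ring_scope.

(* The norm that the library puts on 'rV[R]_d is the sup norm; similitudes are
   taken with respect to the Euclidean one.  The two induce the same topology,
   so continuity and differentiability are the library's. *)
Definition enorm (R : realType) (d : nat) (x : 'rV[R]_d) : R :=
  Num.sqrt (\sum_(j < d) x 0 j ^+ 2).

(* Ratio l = 0 is allowed: S is then constant. *)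
Definition contractive_similitude (R : realType) (d : nat)
    (S : 'rV[R]_d -> 'rV[R]_d) (l : R) : Prop :=
  [/\ 0 <= l, l < 1 & forall x y, enorm (S x - S y) = l * enorm (x - y)].

Definition pta (R : realType) (d : nat) : 'rV[R]_d := 0.

Definition ptb (R : realType) (d : nat) : 'rV[R]_d :=
  \row_(j < d) (val j == 0%N)%:R.

(* The signature is 0-based and boolean: e i stands for eps_(i+1) = 1. *)
Definition pt_start (R : realType) (d : nat) (e : bool) : 'rV[R]_d :=
  (1 - e%:R) *: pta R d + e%:R *: ptb R d.

Definition pt_end (R : realType) (d : nat) (e : bool) : 'rV[R]_d :=
  e%:R *: pta R d + (1 - e%:R) *: ptb R d.

Record similitude_system (R : realType) (d m : nat) (e : 'I_m -> bool)
    (S : 'I_m -> 'rV[R]_d -> 'rV[R]_d) (l : 'I_m -> R) : Prop := {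
  sys_simil : forall i, contractive_similitude (S i) (l i);
  sys_pos2 : m = 2%N -> forall i, 0 < l i;
  sys_first : forall i : 'I_m, val i = 0%N -> S i (pt_start R d (e i)) = pta R d;
  sys_last : forall i : 'I_m, (val i).+1 = m -> S i (pt_end R d (e i)) = ptb R d;
  sys_link : forall i j : 'I_m, val j = (val i).+1 ->
    S i (pt_end R d (e i)) = S j (pt_start R d (e j))
}.

Section Partition.
Variables (R : realType) (m : nat) (e : 'I_m -> bool) (c : 'I_m -> R).

Definition sigma (i : 'I_m) : R :=
  \sum_(j < m | (j < i)%N) c j + (e i)%:R * c i.

Definition phi (i : 'I_m) (t : R) : R := (-1) ^+ e i * c i * t + sigma i.

Definition phi_inv (i : 'I_m) (t : R) : R := (t - sigma i) / ((-1) ^+ e i * c i).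

Lemma phiK (i : 'I_m) : 0 < c i -> cancel (phi i) (phi_inv i).
Proof.
move=> ci t; rewrite /phi_inv /phi addrK mulrAC divff ?mul1r//.
by rewrite mulf_neq0 ?signr_eq0// gt_eqF.
Qed.

Lemma phi_invK (i : 'I_m) : 0 < c i -> cancel (phi_inv i) (phi i).
Proof.
move=> ci t; rewrite /phi_inv /phi mulrC divfK ?subrK//.
by rewrite mulf_neq0 ?signr_eq0// gt_eqF.
Qed.

Definition I_ (i : 'I_m) : set R := phi i @` `[0, 1].

End Partition.

(* Functions on [0, 1] are modelled as functions on R of which only the
   restriction to [0, 1] matters. *)
Definition self_affine_function (R : realType) (d m : nat) (e : 'I_m -> bool)
    (S : 'I_m -> 'rV[R]_d -> 'rV[R]_d) (c : 'I_m -> R) (f : R -> 'rV[R]_d)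
    : Prop :=
  {within `[0, 1], continuous f} /\
  forall (i : 'I_m) (t : R), I_ e c i t -> f t = S i (f (phi_inv e c i t)).

(* Main.v *)
(** Zooming in on [t]: for every [n] there is an affine copy of the graph of [f]
over an interval of length at most [q ^+ n], [q] the largest [c i], containing
[t], and on it the Euclidean distances [|f x - f y|] are multiplied by a common
factor.  Divided by the length of the interval, these distances tend to
[|x - y| * |f'(t)|], so if [f'(t) <> 0] the function [f] is an isometry up to a
constant.  As [|f 1 - f 0| = 1] and the endpoints of the [i]-th piece of [f] are
at distance [l i] over an interval of length [c i], this forces [l i = c i] for
all [i]. *)

Require Import Defs.
From HB Require Import structures.
From mathcomp Require Import all_boot all_order all_algebra.
From mathcomp Require Import all_classical all_reals all_analysis.
From mathcomp Require Import ring lra.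

Import Order.TTheory GRing.Theory Num.Theory.
Import numFieldNormedType.Exports.

Local Open Scope classical_set_scope.
Local Open Scope ring_scope.

(** * The Euclidean norm *)

Lemma enorm0_eq0 (R : realType) (d : nat) (x : 'rV[R]_d) :
  enorm x = 0 -> x = 0.
Proof.
move=> /eqP; rewrite sqrtr_eq0 => x_le0.
have /eqP : \sum_(j < d) x 0 j ^+ 2 = 0.
  by apply/le_anti; rewrite x_le0 sumr_ge0// => j _; rewrite sqr_ge0.
rewrite psumr_eq0 => [/allP x0|j _]; last exact: sqr_ge0.
apply/rowP => j; rewrite mxE; apply/eqP.
by rewrite -sqrf_eq0; apply: (x0 j); rewrite mem_index_enum.
Qed.

Lemma enormZ (R : realType) (d : nat) (k : R) (x : 'rV[R]_d) :
  enorm (k *: x) = `|k| * enorm x.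
Proof.
rewrite /enorm -sqrtr_sqr -sqrtrM ?sqr_ge0// mulr_sumr.
by congr Num.sqrt; apply: eq_bigr => j _; rewrite mxE exprMn.
Qed.

Lemma enorm_ptb (R : realType) (d : nat) : (0 < d)%N -> enorm (ptb R d) = 1.
Proof.
case: d => // d _; rewrite /enorm big_ord_recl big1 => [|j _]; last first.
  by rewrite mxE expr0n.
by rewrite mxE addr0 expr1n sqrtr1.
Qed.

Lemma continuous_enorm (R : realType) (d : nat) :
  continuous (@enorm R d : 'rV[R]_d -> R).
Proof.
have sumC : continuous (fun y : 'rV[R]_d => \sum_j y 0 j ^+ 2).
  apply: (@continuous_big _ _ +%R 0) => [|j _ y]; first exact: add_continuous.
  have cj : z 0 j @[z --> y] --> y 0 j by exact: coord_continuous.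
  exact: (cvgM cj cj).
move=> x; exact: (continuous_comp (sumC x) (@sqrt_continuous R _)).
Qed.

(** * First-order expansion and rescaled increments *)

Lemma derivable_near (R : realType) (V : normedModType R) (f : R -> V)
    (t k : R) :
  derivable f t 1 -> 0 < k ->
  \forall h \near 0, `|f (t + h) - f t - h *: derive1 f t| <= k * `|h|.
Proof.
move=> /derivable_nbhs /eqaddoP df /df; apply: filterS => h.
rewrite derive1E /= !fctE /= opprD addrA (addrC t).
by have -> : h%:A = h by rewrite /GRing.scale /= mulr1.
Qed.

(* The base points [t + a n * (x - s n)] and [t + a n * (y - s n)] need not lie
   on opposite sides of [t]: it suffices that their distance to [t] is
   comparable to [a n]. *)
Lemma derivable_zoom (R : realType) (V : normedModType R) (f : R -> V) (t : R)
    (a s : nat -> R) (x y : R) :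
  derivable f t 1 -> (forall n, a n != 0) -> a @ \oo --> 0 ->
  (forall n, 0 <= s n <= 1) -> 0 <= x <= 1 -> 0 <= y <= 1 ->
  (a n)^-1 *: (f (t + a n * (x - s n)) - f (t + a n * (y - s n)))
    @[n --> \oo] --> (x - y) *: derive1 f t.
Proof.
move=> df a0 cva s01 x01 y01; apply/cvgrPdist_le => eps eps0.
have eps20 : 0 < eps / 2 by rewrite divr_gt0.
have /nbhs_normP[/= r r0 fr] := derivable_near _ _ _ _ _ df eps20.
have bnd n z : 0 <= z <= 1 -> `|z - s n| <= 1.
  by move=> z01; have := s01 n; rewrite ler_norml; lra.
have /cvgr0Pnorm_lt /(_ _ r0) := cva; apply: filterS => n anr.
have rem z : 0 <= z <= 1 -> let h := a n * (z - s n) in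
    `|f (t + h) - f t - h *: derive1 f t| <= eps / 2 * `|a n|.
  move=> z01 /=; have hz : `|a n * (z - s n)| <= `|a n|.
    by rewrite normrM ler_piMr ?bnd.
  apply: le_trans (fr _ _) _; last by rewrite ler_pM2l.
  by rewrite /= sub0r normrN (le_lt_trans hz).
have /= rx := rem x x01; have /= ry := rem y y01.
set D := derive1 f t in rx ry *.
set hx := a n * _ in rx *; set hy := a n * _ in ry *.
(* As [hx - hy = a n * (x - y)], the error is a rescaled difference of two first-order remainders,
   each at most [eps / 2 * |a n|]. *)
have -> : (x - y) *: D - (a n)^-1 *: (f (t + hx) - f (t + hy)) =
  (a n)^-1 *: ((f (t + hy) - f t - hy *: D) - (f (t + hx) - f t - hx *: D)).
  have -> : (x - y) *: D = (a n)^-1 *: (hx *: D - hy *: D).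
    by rewrite -scalerBl scalerA /hx /hy; congr (_ *: _); field.
  rewrite -scalerBr; congr (_ *: _).
  rewrite opprB opprD opprK [RHS]addrACA (opprB (f (t + hx))).
  by rewrite [f (t + hy) - f t + _]addrA subrK addrC [hx *: D - _]addrC.
rewrite normrZ normfV ler_pdivrMl ?normr_gt0// (le_trans (ler_normB _ _))//.
by rewrite (le_trans (lerD ry rx))// -mulrDl -splitr mulrC.
Qed.

(** * The partition of the unit interval *)

Section Addresses.
Variables (R : realType) (m : nat) (e : 'I_m -> bool) (c : 'I_m -> R).
Hypotheses (c_gt0 : forall i, 0 < c i) (c_sum : \sum_i c i = 1).

Let psum (k : nat) : R := \sum_(j < m | (j < k)%N) c j.

Let psumS (i : 'I_m) : psum i.+1 = psum i + c i.
Proof.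
rewrite /psum (bigD1 i) ?ltnS//= addrC; congr (_ + _); apply: eq_bigl => j.
by rewrite ltnS ltn_neqAle andbC.
Qed.

Let psum_ge0 k : 0 <= psum k.
Proof. by apply: sumr_ge0 => j _; exact: ltW. Qed.

Let psum_le1 k : psum k <= 1.
Proof.
rewrite -c_sum /psum [leRHS](bigID (fun j : 'I_m => (j < k)%N)) /= lerDl.
by apply: sumr_ge0 => j _; exact: ltW.
Qed.

(** If [e i] holds, [sigma] is the right endpoint and the slope is negative; reflecting [x] measures
    both orientations from the left endpoint [psum i]. *)
Let phiE i x : phi e c i x = psum i + c i * (if e i then 1 - x else x).
Proof.
by rewrite /phi /sigma -/(psum i); case: (e i); rewrite ?expr0 ?expr1 /=; ring.
Qed.

Lemma phi_itv i x : 0 <= x <= 1 -> 0 <= phi e c i x <= 1.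
Proof.
move=> x01; have := psum_le1 i.+1; rewrite psumS phiE => s1.
have := psum_ge0 i; have := c_gt0 i; case: (e i); nra.
Qed.

(** The index is the least [k] with [t <= psum k.+1]; minimality gives both [psum k <= t] and
    [k < m]. *)
Lemma cover_I t : 0 <= t <= 1 -> exists i, I_ e c i t.
Proof.
move=> /andP[t0 t1].
have psum1 k : (m <= k)%N -> psum k = 1.
  move=> mk; rewrite /psum (eq_bigl xpredT) ?c_sum// => j.
  exact: leq_trans mk.
have tm : exists k, t <= psum k.+1 by exists m; rewrite psum1.
case: (ex_minnP tm) => k tk kmin.
have kt : psum k <= t.
  case: k tk kmin => [|k] _ kmin; first by rewrite /psum big_pred0.
  by rewrite leNgt; apply/negP => /ltW /kmin; rewrite ltnn.
have km : (k < m)%N.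
  rewrite ltnNge; apply/negP => mk.
  case: k mk tk kmin kt => [|k] mk _ kmin _.
    have := psum1 0%N mk; rewrite /psum big_pred0// => /eqP.
    by rewrite eq_sym oner_eq0.
  by have := kmin k; rewrite psum1// => /(_ t1); rewrite ltnn.
pose i := Ordinal km; have ci := c_gt0 i.
have := psumS i; rewrite /= => ski; rewrite ski in tk.
(* Relative position of [t] from the left end of its interval; the preimage is [z] or [1 - z]
   according to orientation. *)
pose z := (t - psum k) / c i.
have z01 : 0 <= z <= 1.
  by rewrite divr_ge0 ?ler_pdivrMr ?mul1r ?subr_ge0 ?lerBlDl// ltW.
have cz : c i * z = t - psum k by rewrite mulrC divfK// gt_eqF.
exists i, (if e i then 1 - z else z); rewrite /= ?phiE /=.
  by rewrite in_itv /=; case: (e i); lra.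
by case: (e i); rewrite ?subKr cz; ring.
Qed.

Lemma weight_lt1 i : (1 < m)%N -> c i < 1.
Proof.
move=> m1.
have [j ji] : exists j : 'I_m, j != i.
  have [i0|i0] := eqVneq (val i) 0%N.
    by exists (Ordinal m1); rewrite -val_eqE /= i0.
  by exists (Ordinal (ltnW m1)); rewrite -val_eqE eq_sym.
rewrite -c_sum (bigD1 i)//= ltrDl (bigD1 j)//= ltr_pwDl//.
by apply: sumr_ge0 => k _; exact: ltW.
Qed.

End Addresses.

(** * Endpoint values and small copies of the graph *)

Section SelfAffine.
Variables (R : realType) (d m : nat) (e : 'I_m -> bool).
Variables (S : 'I_m -> 'rV[R]_d -> 'rV[R]_d) (l : 'I_m -> R) (c : 'I_m -> R).
Variable f : R -> 'rV[R]_d.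
Hypotheses (m_gt1 : (1 < m)%N) (hS : similitude_system e S l).
Hypotheses (c_gt0 : forall i, 0 < c i) (c_sum : \sum_i c i = 1).
Hypothesis hf : self_affine_function e S c f.

Lemma self_affine_phi i x : 0 <= x <= 1 -> f (phi e c i x) = S i (f x).
Proof.
move=> x01; rewrite (hf.2 i) ?phiK//.
by exists x => //=; rewrite in_itv.
Qed.

(** The errors [D] at the two endpoints satisfy linear relations with factors below [1], coming from
    the first and last pieces, so both vanish. *)
Lemma self_affine_endpoints : f 0 = 0 /\ f 1 = ptb R d.
Proof.
pose P (b : bool) : 'rV[R]_d := b%:R *: ptb R d.
pose F (b : bool) : 'rV[R]_d := f b%:R.
pose D b := enorm (F b - P b).
have b01 (b : bool) : 0 <= (b%:R : R) <= 1 by case: b; rewrite /= ?ler01 lexx.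
pose i0 : 'I_m := Ordinal (ltnW m_gt1).
have m1m : (m.-1 < m)%N by case: (m) m_gt1.
pose i1 : 'I_m := Ordinal m1m.
(* [phi] of the first index sends [e i0] to [0], and [S i0] sends [P (e i0)] to the origin. *)
have D0 : D false = l i0 * D (e i0).
  have [_ _ <-] := sys_simil hS i0; rewrite -self_affine_phi//.
  have := sys_first hS (erefl : val i0 = 0%N).
  rewrite /pt_start /pta scaler0 add0r => ->.
  rewrite /D /F /P /= scale0r; congr (enorm (f _ - _)).
  rewrite /phi /sigma big_pred0//.

  rewrite add0r; case: (e i0); last by rewrite mulr0 mul0r addr0.
  by rewrite expr1 mulN1r mulr1 mul1r addNr.
have i1m : (val i1).+1 = m by rewrite /= prednK// ltnW.
have D1 : D true = l i1 * D (~~ e i1).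
  have [_ _ <-] := sys_simil hS i1; rewrite -self_affine_phi//.
  have := sys_last hS i1m.
  rewrite /pt_end /pta scaler0 add0r.
  have -> : 1 - (e i1)%:R = (~~ e i1)%:R :> R.
    by case: (e i1); rewrite ?subrr ?subr0.
  move=> ->; rewrite /D /F /P scale1r; congr (enorm (f _ - _)).
  have sum_i1 : \sum_(j < m | (j < i1)%N) c j = 1 - c i1.
    apply/eqP; rewrite eq_sym subr_eq -c_sum (bigD1 i1)//= addrC.
    apply/eqP; congr (_ + _); apply: eq_bigl => j.
    by rewrite ltn_neqAle -ltnS i1m ltn_ord andbT -val_eqE.
  rewrite /phi /sigma sum_i1.
  case: (e i1); first by rewrite mulr0 add0r mul1r subrK.
  by rewrite expr0 mul1r mulr1 mul0r addr0 addrC subrK.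
have [l0 l01 _] := sys_simil hS i0.
have [l1 l11 _] := sys_simil hS i1.
have fix0 (k x : R) : k < 1 -> x = k * x -> x = 0.
  move=> k1 /eqP; rewrite -subr_eq0 -{1}[x]mul1r -mulrBl mulf_eq0 subr_eq0.
  by rewrite eq_sym lt_eqF// => /eqP.
have [Df Dt] : D false = 0 /\ D true = 0.
  (* If both end pieces are reversed, the two errors refer to each other and the product of the
     ratios contracts; otherwise one error refers to itself. *)
  have l01_lt1 : l i0 * l i1 < 1 by rewrite mulr_ilt1.
  case: (e i0) D0; case: (e i1) D1 => /= D1 D0.
  - have Df : D false = 0 by apply: fix0 l01_lt1 _; rewrite -mulrA -D1.
    by rewrite D1 Df mulr0.
  - by have Dt := fix0 _ _ l11 D1; rewrite D0 Dt mulr0.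
  - by have Df := fix0 _ _ l01 D0; rewrite D1 Df mulr0.
  - by rewrite (fix0 _ _ l01 D0) (fix0 _ _ l11 D1).
move: (enorm0_eq0 _ _ _ Df) (enorm0_eq0 _ _ _ Dt).
rewrite /F /P /= scale0r scale1r subr0 => -> /eqP.
by rewrite subr_eq0 => /eqP ->.
Qed.

Let q := \big[Num.max/0]_i c i.

(** The map [x |-> t + a * (x - s)] is a composition of [n] maps [phi e c i] sending [s] to [t],
    with signed slope [a]; [L] is the product of the ratios. The induction adds the outermost
    map. *)
Lemma affine_copy n t : 0 <= t <= 1 -> exists a s L : R,
  [/\ a != 0, `|a| <= q ^+ n, 0 <= s <= 1,
    forall x, 0 <= x <= 1 -> 0 <= t + a * (x - s) <= 1 &
    forall x y, 0 <= x <= 1 -> 0 <= y <= 1 ->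
      enorm (f (t + a * (x - s)) - f (t + a * (y - s))) =
      L * enorm (f x - f y)].
Proof.
elim: n t => [|n IHn] t t01.
  exists 1, t, 1; split => [|||x|x y] //;
    by rewrite ?oner_neq0 ?normr1 ?mul1r ?subrKC.
have [i [u /=]] := cover_I _ _ e _ c_gt0 c_sum _ t01.
rewrite in_itv /= => u01 ut.
have [a [s [L [a0 aq s01 asx fL]]]] := IHn u u01.
pose k := (-1) ^+ e i * c i.
have kE x : t + k * a * (x - s) = phi e c i (u + a * (x - s)).
  by rewrite -ut /phi -/k; ring.
exists (k * a), s, (l i * L); split => [|||x x01|x y x01 y01] //.
- by rewrite !mulf_eq0 signr_eq0 (negbTE a0) gt_eqF.
- rewrite !normrM normr_sign mul1r exprS ler_pM//.
  by rewrite gtr0_norm//; exact: le_bigmax.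
- by rewrite kE phi_itv// asx.
rewrite !kE !self_affine_phi ?asx//.
by have [_ _ ->] := sys_simil hS i; rewrite fL// mulrA.
Qed.

(** Both sides are limits of [L n / |a n|] times the two distances. The cross-multiplied form avoids
    dividing by [enorm (f x - f y)], which may vanish. *)
Lemma derivable_self_affine_dist t x y x' y' : 0 <= t <= 1 -> derivable f t 1 ->
  0 <= x <= 1 -> 0 <= y <= 1 -> 0 <= x' <= 1 -> 0 <= y' <= 1 ->
  `|x - y| * enorm (derive1 f t) * enorm (f x' - f y') =
  `|x' - y'| * enorm (derive1 f t) * enorm (f x - f y).
Proof.
move=> t01 df x01 y01 x'01 y'01.
have /choice[a] := fun n => affine_copy n _ t01.
move=> /choice[s] /choice[L copy].
have q0 : 0 <= q by apply: le_trans (le_bigmax _ _ (Ordinal m_gt1)); exact: ltW.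
have q1 : q < 1 by apply/bigmax_ltP; split => // i _; exact: weight_lt1.
have cva : a @ \oo --> 0.
  apply: norm_cvg0; apply: (@squeeze_cvgr _ _ _ _ (cst 0) (fun n => q ^+ n)).
  - by apply: nearW => n; rewrite normr_ge0; have [] := copy n.
  - exact: cvg_cst.
  - by apply: cvg_expr; rewrite ger0_norm.
have cvL z w : 0 <= z <= 1 -> 0 <= w <= 1 ->
    L n / `|a n| * enorm (f z - f w) @[n --> \oo] -->
    `|z - w| * enorm (derive1 f t).
  move=> z01 w01; rewrite -enormZ.
  have dz : (a n)^-1 *: (f (t + a n * (z - s n)) - f (t + a n * (w - s n)))
      @[n --> \oo] --> (z - w) *: derive1 f t.
    by apply: derivable_zoom => // n; have [] := copy n.
  apply: cvg_trans (continuous_cvg _ (@continuous_enorm R d _) dz).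
  apply: near_eq_cvg; apply: nearW => n /=.
  have [_ _ _ _ scale] := copy n.
  by rewrite enormZ scale// normfV mulrA [_^-1 * _]mulrC.
have cvLM z w k : 0 <= z <= 1 -> 0 <= w <= 1 ->
    L n / `|a n| * (enorm (f z - f w) * k) @[n --> \oo] -->
    `|z - w| * enorm (derive1 f t) * k.
  move=> z01 w01; under eq_cvg do rewrite mulrA.
  by apply: cvgM (cvL z w z01 w01) _; exact: cvg_cst.
have lim1 := cvLM x y (enorm (f x' - f y')) x01 y01.
have lim2 := cvLM x' y' (enorm (f x - f y)) x'01 y'01.
by rewrite [enorm (f x - f y) * _]mulrC in lim1; exact: (cvg_unique (@Rhausdorff R) lim1 lim2).
Qed.

End SelfAffine.

Theorem proposition2p1 (R : realType) (d m : nat) (hd : (1 <= d)%N)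
    (hm : (2 <= m)%N) (e : 'I_m -> bool)
    (S : 'I_m -> 'rV[R]_d -> 'rV[R]_d) (l : 'I_m -> R)
    (hS : similitude_system e S l)
    (c : 'I_m -> R) (hc : forall i, 0 < c i) (hc1 : \sum_(i < m) c i = 1)
    (hlc : ~ (forall i, l i = c i))
    (f : R -> 'rV[R]_d) (hf : self_affine_function e S c f)
    (t : R) (ht : 0 < t < 1) (hder : derivable f t 1) :
  derive1 f t = 0.
Proof.
apply: contra_notP hlc => df0 i.
have V0 : enorm (derive1 f t) != 0.
  by apply: contra_not_neq df0; exact: enorm0_eq0.
have [f0 f1] := self_affine_endpoints _ _ _ _ _ _ _ _ hm hS hc hc1 hf.
have i0 : 0 <= (0 : R) <= 1 by rewrite lexx ler01.
have i1 : 0 <= (1 : R) <= 1 by rewrite lexx ler01.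
have t01 : 0 <= t <= 1 by case/andP: ht => /ltW -> /ltW ->.
(* Comparing the pair [1, 0] with its image under [phi e c i] gives [l i = c i] after cancelling the
   norm of the derivative. *)
have := derivable_self_affine_dist _ _ _ _ _ _ _ _ hm hS hc hc1 hf
  _ _ _ _ _ t01 hder i1 i0
  (phi_itv _ _ e _ hc hc1 i _ i1) (phi_itv _ _ e _ hc hc1 i _ i0).
rewrite !(self_affine_phi _ _ _ _ _ _ _ hc hf)//.
have [_ _ ->] := sys_simil hS i.
rewrite f0 f1 !subr0 enorm_ptb// normr1 mul1r mulr1.
have -> : `|phi e c i 1 - phi e c i 0| = c i.
  rewrite /phi mulr1 mulr0 add0r addrK normrM normr_sign mul1r.
  by rewrite gtr0_norm.
by rewrite mulr1 mulrC => /(mulIf V0).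
Qed.
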